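(* Let $n\ge 1$ and $\vec p=(p_1,\dots,p_n),\vec q=(q_1,\dots,q_n)\in[0,1]^n$. Let $S_{\vec p}$ denote a sum of $n$ independent random variables $X_i\sim\mathrm{Ber}(p_i)$, and similarly $S_{\vec q}$. Define $$\Delta=\sum_{i=1}^n|p_i-q_i|,\qquad \sigma_{\vec p}^2=\sum_{i=1}^n p_i(1-p_i),\qquad \sigma_{\vec q}^2=\sum_{i=1}^n q_i(1-q_i),$$ $$\Phi(\vec p,\vec q)=\min\Big(1,\frac{\Delta}{\sqrt{\sigma_{\vec p}^2+1}}\Big),\qquad \Phi(\vec q,\vec p)=\min\Big(1,\frac{\Delta}{\sqrt{\sigma_{\vec q}^2+1}}\Big).$$ Then $$\mathrm{TV}(S_{\vec p},S_{\vec q})\le C_{\mathrm{BCV}}\,\min\big(\Phi(\vec p,\vec q),\Phi(\vec q,\vec p)\big).$$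
   Context: $\mathrm{TV}$ is the total variation distance between laws on a finite set, $\mathrm{TV}(P,Q)=\frac12\sum_\omega|P(\omega)-Q(\omega)|$; for random variables it means the TV distance of their laws. $\eta_{\mathrm{BCV}}$ is the sharp universal constant of Baillon–Cominetti–Vaisman: the smallest constant such that every finite sum $Z$ of independent Bernoulli random variables with $\mathrm{Var}(Z)>0$ satisfies $\max_k\mathbb P(Z=k)\le \eta_{\mathrm{BCV}}/\sqrt{\mathrm{Var}(Z)}$ (numerically $\eta_{\mathrm{BCV}}\approx0.4688223555$). Set $C_{\mathrm{BCV}}=\sqrt{5/4+\eta_{\mathrm{BCV}}^2}\approx1.2123507747$. *)

(* Defs.v *)
From mathcomp Require Import all_boot all_order all_algebra.
Set Implicit Arguments. Unset Strict Implicit. Unset Printing Implicit Defensive.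
Import Order.TTheory GRing.Theory Num.Theory.
Local Open Scope ring_scope.

Section Defs.
Variable R : rcfType.

(* Law of S_p = X_1 + ... + X_n, X_i ~ Ber(p_i) independent:
   P(S_p = k) = sum over sets A of indices of size k of
   prod_{i in A} p_i * prod_{i notin A} (1 - p_i). *)
Definition bern_sum_pmf (n : nat) (p : 'I_n -> R) (k : nat) : R :=
  \sum_(A : {set 'I_n} | #|A| == k)
     (\prod_(i in A) p i) * (\prod_(i in ~: A) (1 - p i)).

Definition bern_sum_var (n : nat) (p : 'I_n -> R) : R :=
  \sum_(i < n) p i * (1 - p i).

(* Total variation distance of the laws of S_p and S_q (both supported on {0..n}). *)
Definition tv_bern_sum (n : nat) (p q : 'I_n -> R) : R :=
  2^-1 * \sum_(k < n.+1) `|bern_sum_pmf p k - bern_sum_pmf q k|.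

Definition is_prob_vec (n : nat) (p : 'I_n -> R) : Prop :=
  forall i, 0 <= p i <= 1.

Definition bcv_valid (c : R) : Prop :=
  forall (n : nat) (p : 'I_n -> R), is_prob_vec p -> 0 < bern_sum_var p ->
    forall k : nat, bern_sum_pmf p k <= c / Num.sqrt (bern_sum_var p).

Definition is_eta_BCV (eta : R) : Prop :=
  bcv_valid eta /\ forall c, bcv_valid c -> eta <= c.

Definition C_BCV (eta : R) : R := Num.sqrt (5 / 4 + eta ^+ 2).

Definition Delta (n : nat) (p q : 'I_n -> R) : R := \sum_(i < n) `|p i - q i|.

Definition Phi (n : nat) (p q : 'I_n -> R) : R :=
  Num.min 1 (Delta p q / Num.sqrt (bern_sum_var p + 1)).

End Defs.

(* Main.v *)
(** Moving the coordinates one at a time from [p] to [q], and using that a Poisson-binomial law is log-concave, hence unimodal, gives [TV <= sum_i |p_i - q_i| M_i], where [M_i] is the largest atom of the sum without coordinate [i]. Fourier inversion together with [|1 - a + a z| <= 1 - a (1 - a) (1 - Re z)] for [|z| = 1] bounds any atom by the central atom of a symmetric log-concave law with the same variance [y]; comparison with a two-sided geometric law then yields [M ^ 2 (1 + 2 y) <= 1].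

If every coordinate has a smaller variance in [q] than in [p], the convex bound [1 / sqrt (1 + 2 y)] is replaced by its chord on [[0, Var S_p]]. Being affine in [y], the chord can be averaged over the path from [p] to [q] and the path from [q] to [p], and this gives [TV <= (6/5) Delta / sqrt (Var S_p + 1)]. In general one goes through the vector that takes, in each coordinate, whichever of [p_i], [q_i] has the larger variance.

Finally [C_BCV >= 6/5] because [eta ^ 2 >= 19/100], as a sum of eight Bernoulli variables shows. *)
Require Import Defs.
From mathcomp Require Import all_boot all_order all_algebra.
From mathcomp Require Import separable cyclotomic complex ring lra zify.
Set Implicit Arguments. Unset Strict Implicit. Unset Printing Implicit Defensive.
Import Order.TTheory GRing.Theory Num.Theory.
Local Open Scope ring_scope.

(** * Generating polynomials and log-concavity *)

Definition bern_poly (R : nzRingType) (a : R) : {poly R} :=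
  (1 - a)%:P + a%:P * 'X.

Definition pgf (R : rcfType) (n : nat) (p : 'I_n -> R) : {poly R} :=
  \prod_(i < n) bern_poly (p i).

(** The four-point form needs no subtraction of indices. It also rules out internal zeros, which the
    local condition [f (k-1) * f (k+1) <= f k ^ 2] would allow. *)
Definition log_concave (R : rcfType) (f : nat -> R) : Prop :=
  (forall k, 0 <= f k) /\
  forall a b c, f a * f (a + b + c)%N <= f (a + b)%N * f (a + c)%N.

Lemma coef_pgf (R : rcfType) (n : nat) (p : 'I_n -> R) (k : nat) :
  (pgf p)`_k = bern_sum_pmf p k.
Proof.
have -> : pgf p = \prod_(i < n) ((p i)%:P * 'X + (1 - p i)%:P).
  by apply: eq_bigr => i _; rewrite addrC.
have termE (A : {set 'I_n}) : \prod_i (if i \in A then (p i)%:P * 'X else (1 - p i)%:P)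
    = ((\prod_(i in A) p i) * \prod_(i in ~: A) (1 - p i))%:P * 'X^#|A|.
  rewrite (bigID (mem A)) /= (eq_bigr (fun i => (p i)%:P * 'X)); last by move=> i ->.
  rewrite [X in _ * X = _](eq_bigr (fun i => (1 - p i)%:P)); last by move=> i /negbTE ->.
  rewrite big_split /= prodr_const -!rmorph_prod mulrAC -rmorphM /=.
  by congr ((_ * _)%:P * _); apply: eq_bigl => i; rewrite inE.
rewrite bigA_distr coef_sum /bern_sum_pmf.
rewrite (bigID (fun A : {set 'I_n} => #|A| == k)) /= [X in _ + X]big1 ?addr0.
  apply: eq_big => [A|A /eqP cA] //.
  by rewrite termE coefCM coefXn cA eqxx mulr1.
by move=> A cA; rewrite termE coefCM coefXn eq_sym (negbTE cA) mulr0.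
Qed.

Lemma coef_bern_polyM (R : rcfType) (a : R) (F : {poly R}) (k : nat) :
  (bern_poly a * F)`_k = (1 - a) * F`_k + a * (if k is j.+1 then F`_j else 0).
Proof. by rewrite mulrDl coefD coefCM -mulrA coefCM coefXM; case: k. Qed.

(** Multiplying by [bern_poly a] mixes [F] with its shift [g]. The four-point inequality of the
    mixture is the sum of those for [F], for [g] and for the two cross pairs, with weights
    [(1-a)^2], [a^2] and [a(1-a)]. *)
Lemma log_concave_bern_polyM (R : rcfType) (a : R) (F : {poly R}) :
  0 <= a <= 1 -> log_concave (fun k => F`_k) ->
  log_concave (fun k => (bern_poly a * F)`_k).
Proof.
move=> /andP[a0 a1] [F0 FL]; have b0 : 0 <= 1 - a by rewrite subr_ge0.
pose g k := if k is j.+1 then F`_j else 0.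
have g0 k : 0 <= g k by case: k => [|k] /=.
have gL x b c : g x * g (x + b + c)%N <= g (x + b)%N * g (x + c)%N.
  case: x => [|x]; first by rewrite mul0r mulr_ge0.
  by rewrite !addSn; exact: FL.
have L1 x b c : F`_x * g (x + b + c).+2 <= F`_(x + b).+1 * g (x + c).+1.
  by have := FL x b.+1 c; rewrite /= !(addnS, addSn).
have L2 x b c : g x * F`_(x + b + c).+2 <= g (x + b).+1 * F`_(x + c).+1.
  case: x => [|x]; first by rewrite mul0r mulr_ge0.
  by have := FL x b.+1 c.+2; rewrite /= !(addnS, addSn).
split=> [k|x b c]; rewrite !coef_bern_polyM -!/(g _).
  by rewrite addr_ge0 // mulr_ge0.
(* A zero gap makes the two sides equal; for positive gaps the cross inequalities [L1] and [L2]
   apply. *)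
case: b => [|b]; first by rewrite !addn0 mulrC.
case: c => [|c]; first by rewrite !addn0 mulrC.
have h1 := FL x b.+1 c.+1; have h2 := gL x b.+1 c.+1.
have h3 := L1 x b c; have h4 := L2 x b c.
rewrite !(addnS, addSn) in h1 h2 *.
have : 0 <= (1 - a) ^+ 2 * (F`_(x + b).+1 * F`_(x + c).+1 - F`_x * F`_(x + b + c).+2)
  by rewrite mulr_ge0 ?sqr_ge0 ?subr_ge0.
have : 0 <= a ^+ 2 * (g (x + b).+1 * g (x + c).+1 - g x * g (x + b + c).+2)
  by rewrite mulr_ge0 ?sqr_ge0 ?subr_ge0.
have : 0 <= (a * (1 - a)) * (F`_(x + b).+1 * g (x + c).+1 - F`_x * g (x + b + c).+2)
  by rewrite mulr_ge0 ?mulr_ge0 ?subr_ge0.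
have : 0 <= (a * (1 - a)) * (g (x + b).+1 * F`_(x + c).+1 - g x * F`_(x + b + c).+2)
  by rewrite mulr_ge0 ?mulr_ge0 ?subr_ge0.
lra.
Qed.

(** The free factor [F] makes it possible to multiply two generating polynomials, as the symmetrized
    law requires. *)
Lemma log_concave_pgfM (R : rcfType) (n : nat) (p : 'I_n -> R) (F : {poly R}) :
  is_prob_vec p -> log_concave (fun k => F`_k) ->
  log_concave (fun k => (pgf p * F)`_k).
Proof.
move=> hp hF; rewrite /pgf; elim/big_rec: _ => [|i P _ IH]; first by rewrite mul1r.
by rewrite -mulrA; apply: log_concave_bern_polyM.
Qed.

Lemma log_concave1 (R : rcfType) : log_concave (fun k => (1 : {poly R})`_k).
Proof.
split=> [k|a b c]; first by rewrite coef1 ler0n.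
rewrite !coef1 -!natrM ler_nat.
by case: a => [|a]; case: b => [|b]; case: c => [|c]; rewrite ?addn0.
Qed.

Lemma log_concave_pgf (R : rcfType) (n : nat) (p : 'I_n -> R) :
  is_prob_vec p -> log_concave (fun k => (pgf p)`_k).
Proof.
by move=> hp; rewrite -[pgf p]mulr1; apply/log_concave_pgfM/log_concave1.
Qed.

Lemma size_pgf (R : rcfType) (n : nat) (p : 'I_n -> R) : (size (pgf p) <= n.+1)%N.
Proof.
apply: leq_trans (size_prod_leq _ _) _; rewrite /= card_ord leq_subLR.
have : (\sum_(i < n) size (bern_poly (p i)) <= \sum_(i < n) 2)%N.
  apply: leq_sum => i _; apply: leq_trans (size_polyD _ _) _.
  rewrite geq_max (leq_trans (size_polyC_leq1 _)) //=.
  by rewrite mulrC; apply: leq_trans (size_polyMleq _ _) _; rewrite size_polyX size_polyC; case: (p i == 0).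
by rewrite sum_nat_const card_ord muln2 -addnn addnS ltnS.
Qed.

Lemma horner_bern_poly (R : comNzRingType) (a x : R) :
  (bern_poly a).[x] = 1 - a + a * x.
Proof. by rewrite /bern_poly !hornerE. Qed.

Lemma pgf1 (R : rcfType) (n : nat) (p : 'I_n -> R) : (pgf p).[1] = 1.
Proof.
by rewrite horner_prod big1 // => i _; rewrite horner_bern_poly mulr1 subrK.
Qed.

Lemma deriv_bern_poly (R : nzRingType) (a : R) : (bern_poly a)^`() = a%:P.
Proof. by rewrite /bern_poly derivD derivM !derivC derivX mul0r !add0r mulr1. Qed.

(** These are the first two factorial moments, from which the variance of the symmetrized law is
    computed. *)
Lemma deriv_pgf (R : rcfType) (n : nat) (p : 'I_n -> R) :
  (pgf p)^`().[1] = \sum_(i < n) p i /\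
  (pgf p)^`()^`().[1] = (\sum_(i < n) p i) ^+ 2 - \sum_(i < n) p i ^+ 2.
Proof.
suff : [/\ (pgf p).[1] = 1, (pgf p)^`().[1] = \sum_(i < n) p i &
  (pgf p)^`()^`().[1] = (\sum_(i < n) p i) ^+ 2 - \sum_(i < n) p i ^+ 2] by case.
rewrite /pgf; elim: (index_enum _) => [|i s [IH0 IH1 IH2]].
  by rewrite !big_nil !derivC !hornerE; split=> //; ring.
set P := \prod_(j <- s) _ in IH0 IH1 IH2 *; rewrite !big_cons -/P.
have D1 (F : {poly R}) : (bern_poly (p i) * F)^`() = (p i)%:P * F + bern_poly (p i) * F^`().
  by rewrite derivM deriv_bern_poly.
have D2 : (bern_poly (p i) * P)^`()^`() =
    (p i)%:P * P^`() + ((p i)%:P * P^`() + bern_poly (p i) * P^`()^`()).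
  by rewrite D1 derivD D1 derivM derivC mul0r add0r.
rewrite D2 D1 !hornerD !hornerM !hornerC horner_bern_poly IH0 IH1 IH2.
by split; ring.
Qed.

(** * Roots of unity and Fourier inversion *)

(** [X^n - 1] splits and is separable, so it has [n] distinct roots, and [n] distinct [n]-th roots
    of unity include a primitive one. *)
Lemma prim_root_exists (C : numClosedFieldType) (n : nat) :
  (0 < n)%N -> exists z : C, n.-primitive_root z.
Proof.
pose p : {poly C} := 'X^n - 1; have [r Dp] := closed_field_poly_normal p.
move=> n_gt0; rewrite (monicP _) ?monicXnsubC // scale1r in Dp.
have rn1 : all n.-unity_root r by apply/allP => z; rewrite -root_prod_XsubC -Dp.
have sz_r : (n < (size r).+1)%N by rewrite -(size_prod_XsubC r id) -Dp size_XnsubC.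
have [|z] := hasP (cyclic.has_prim_root n_gt0 rn1 _ sz_r); last by exists z.
by rewrite -separable_prod_XsubC -Dp separable_Xn_sub_1 // pnatr_eq0 -lt0n.
Qed.

Lemma fourier_coef (C : numClosedFieldType) (N : nat) (z : C) (P : {poly C}) (k : nat) :
  N.-primitive_root z -> (size P <= N)%N -> (k < N)%N ->
  N%:R * P`_k = \sum_(j < N) (z ^+ j) ^- k * P.[z ^+ j].
Proof.
move=> pz sP kN; have zN := prim_expr_order pz.
have z0 : z != 0.
  by apply: contraTneq kN => z0; case: N zN {pz sP} => // N; rewrite z0 expr0n => /eqP; rewrite eq_sym oner_eq0.
under eq_bigr => j _ do rewrite (horner_coef_wide _ sP) mulr_sumr.
rewrite exchange_big /= (bigD1 (Ordinal kN)) //= [X in _ + X]big1 ?addr0.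
  rewrite (eq_bigr (fun=> P`_k)); first by rewrite sumr_const card_ord mulr_natl.
  by move=> j _; rewrite mulrCA mulVf ?mulr1 // !expf_neq0.
move=> m; rewrite -val_eqE /= => mk.
have e (j : nat) : (z ^+ j) ^- k * (P`_m * (z ^+ j) ^+ m) = P`_m * (z ^+ m / z ^+ k) ^+ j.
  rewrite mulrCA; congr (_ * _); rewrite exprMn exprVn -!exprM ![(_ * j)%N]mulnC mulrC; done.
under eq_bigr => j _ do rewrite e.
(* Orthogonality: [w] is an [N]-th root of unity other than [1], so its geometric sum vanishes. *)
rewrite -mulr_sumr; set w := _ / _.
have wN : w ^+ N = 1 by rewrite exprMn exprVn -!exprM ![(_ * N)%N]mulnC !exprM zN !expr1n invr1 mulr1.
have w1 : w - 1 != 0.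
  rewrite subr_eq0; apply: contra mk => /eqP w1.
  have : z ^+ m = z ^+ k by rewrite -[LHS](divfK (expf_neq0 k z0)) -/w w1 mul1r.
  by move/eqP; rewrite (eq_prim_root_expr pz) !modn_small.
have := subrX1 w N; rewrite wN subrr => /esym/eqP; rewrite mulf_eq0 (negbTE w1) /= => /eqP ->.
by rewrite mulr0.
Qed.

(* [sqrt (1 - 2 t) <= 1 - t], applied to [|1 - a + a z| ^ 2 = 1 - 2 a (1 - a) (1 - Re z)]. *)
Lemma norm_bern_le (C : numClosedFieldType) (a z : C) : 0 <= a <= 1 -> `|z| = 1 ->
  `|1 - a + a * z| <= 1 - a * (1 - a) + a * (1 - a) * 'Re z.
Proof.
move=> /andP[a0 a1] nz; have b0 : 0 <= 1 - a by rewrite subr_ge0.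
have zz : z * z^* = 1 by rewrite -normCK nz expr1n.
have aR : a^* = a by apply/CrealP/ger0_real.
have Rz : z + z^* = 2 * 'Re z by rewrite [in RHS]ReE mulrC divfK ?pnatr_eq0.
have R1 : 0 <= 1 + 'Re z.
  have hR := Creal_Re z; have : `|'Re z| <= 1 by rewrite -nz; exact: (leif_normC_Re_Creal z).1.
  by rewrite real_ler_norml // => /andP[h _]; rewrite -lerBlDl sub0r.
have v0 : 0 <= a * (1 - a) by rewrite mulr_ge0.
rewrite -ler_sqr ?nnegrE ?normr_ge0 //; last first.
  have -> : 1 - a * (1 - a) + a * (1 - a) * 'Re z =
    a ^+ 2 + (1 - a) ^+ 2 + a * (1 - a) * (1 + 'Re z) by ring.
  by rewrite !addr_ge0 ?exprn_ge0 // mulr_ge0.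
rewrite normCK rmorphD rmorphM rmorphB rmorph1 /= aR -subr_ge0.
have -> : (1 - a + a * z) * (1 - a + a * z^*)
  = (1 - a) ^+ 2 + a * (1 - a) * (z + z^*) + a ^+ 2 * (z * z^*) by ring.
rewrite zz Rz.
have -> : (1 - a * (1 - a) + a * (1 - a) * 'Re z) ^+ 2 -
  ((1 - a) ^+ 2 + a * (1 - a) * (2 * 'Re z) + a ^+ 2 * 1) =
  (a * (1 - a)) ^+ 2 * (1 - 'Re z) ^+ 2 by ring.
apply: mulr_ge0; first exact: exprn_ge0.
by apply: real_exprn_even_ge0; rewrite // realB ?real1 // Creal_Re.
Qed.

(** * The symmetric comparison law *)

(** Independent [Ber(b)] and [Ber(1-b)] then have a sum that is symmetric about [1] and has variance
    [v]. Such a pair replaces a coordinate of variance [v]. *)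
Lemma exists_half_variance (R : rcfType) (v : R) : 0 <= v <= 4^-1 ->
  exists2 b, 0 <= b <= 1 & b * (1 - b) = v / 2.
Proof.
move=> hv; have h0 : 0 <= 1 - 2 * v by lra.
have sq := sqr_sqrtr h0; have := sqrtr_ge0 (1 - 2 * v).
set s := Num.sqrt _ in sq *; move=> s0.
exists ((1 - s) / 2); last by lra.
have : s <= 1 by nra.
lra.
Qed.

Section Fourier.
Variables (R : rcfType) (C : numClosedFieldType) (f : {rmorphism R -> C}).
Hypothesis f_le : {mono f : x y / x <= y}.
Variables (n : nat) (p b : 'I_n -> R).
Hypothesis hp : is_prob_vec p.
Hypothesis hb : forall i, b i * (1 - b i) = p i * (1 - p i) / 2.
Variables (N : nat) (z : C).
Hypothesis pz : N.-primitive_root z.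
Hypothesis nN : (n.*2 < N)%N.

Let T := pgf b * pgf (fun i => 1 - b i).
(** The characteristic function, at [z ^+ j], of the law [T] centred at [n]. It is real, and it
    dominates the modulus of that of [S_p]. *)
Let B j := \prod_(i < n) (1 - f (p i * (1 - p i)) + f (p i * (1 - p i)) * 'Re (z ^+ j)).

Let size_T : (size T <= n.*2.+1)%N.
Proof.
apply: leq_trans (size_polyMleq _ _) _.
have := size_pgf b; have := size_pgf (fun i => 1 - b i); rewrite -addnn; lia.
Qed.

Let norm_zX j : `|z ^+ j| = 1.
Proof.
have N0 := prim_order_gt0 pz.
rewrite normrX; suff -> : `|z| = 1 by rewrite expr1n.
apply/eqP; rewrite -(@pexpr_eq1 _ _ N) ?normr_ge0 //.
by rewrite -normrX (prim_expr_order pz) normr1.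
Qed.

(** Coordinatewise, [(1-b+bw)(b+(1-b)w) = w(1-2v+2v Re w)] with [v = b(1-b)], because the inverse of
    [w] is its conjugate. *)
Let horner_T j : (map_poly f T).[z ^+ j] = (z ^+ j) ^+ n * B j.
Proof.
have zz : (z ^+ j) * (z ^+ j)^* = 1 by rewrite -normCK norm_zX expr1n.
have Rz : (z ^+ j) + (z ^+ j)^* = 2 * 'Re (z ^+ j).
  by rewrite [in RHS]ReE mulrC divfK ?pnatr_eq0.
rewrite rmorphM hornerM /pgf !rmorph_prod !horner_prod -big_split /=.
have -> : (z ^+ j) ^+ n = \prod_(i < n) z ^+ j by rewrite prodr_const card_ord.
rewrite -big_split /=.
apply: eq_bigr => i _; set w := z ^+ j in zz Rz *.
have e (a : R) : (map_poly f (bern_poly a)).[w] = 1 - f a + f a * w.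
  rewrite -[1 in RHS](rmorph1 f) -rmorphB.
  by rewrite [X in X.[_]]rmorphD [X in (_ + X).[_]]rmorphM /= !map_polyC map_polyX !hornerE.
rewrite !e.
have := congr1 f (hb i); rewrite rmorphM rmorphB rmorph1 fmorph_div rmorph_nat => hbi.
have -> : f (p i * (1 - p i)) = 2 * (f (b i) * (1 - f (b i))).
  by rewrite hbi [RHS]mulrC divfK ?pnatr_eq0.
have -> : w * (1 - 2 * (f (b i) * (1 - f (b i))) + 2 * (f (b i) * (1 - f (b i))) * 'Re w)
  = w * (1 - 2 * (f (b i) * (1 - f (b i)))) + f (b i) * (1 - f (b i)) * (w * (2 * 'Re w)) by ring.
by rewrite -Rz [w * (_ + _)]mulrDr zz; ring.
Qed.

Let coef_symmetrized k : (k <= n.*2)%N -> N%:R * f T`_k = \sum_(j < N) (z ^+ j) ^- k * ((z ^+ j) ^+ n * B j).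
Proof.
move=> kn; rewrite -coef_map (fourier_coef pz).
- by apply: eq_bigr => j _; rewrite horner_T.
- by apply: leq_trans (leq_trans (size_poly _ _) size_T) nN.
- exact: leq_ltn_trans kn nN.
Qed.

Let z0 : z != 0.
Proof. by rewrite -normr_eq0 -[z]expr1 norm_zX oner_eq0. Qed.

Let Re_f x : (f x)^* = f x.
Proof.
by apply/CrealP; rewrite realE -(rmorph0 f) !f_le le_total.
Qed.

(** In the inversion formula the indices [n+k] and [n-k] carry the conjugate weights [w^-k] and
    [w^k] against the real [B j], and the coefficients themselves are real. *)
Lemma coef_symmetrized_sym k : (k <= n)%N -> T`_(n + k) = T`_(n - k).
Proof.
move=> kn; apply: (fmorph_inj f); rewrite -[LHS]Re_f.
have N0 : (N%:R : C) != 0 by rewrite pnatr_eq0 -lt0n (prim_order_gt0 pz).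
apply: (mulfI N0); rewrite coef_symmetrized; last by rewrite -addnn leq_subLR; lia.
rewrite -(conjC_nat _ N) -rmorphM coef_symmetrized; last by rewrite -addnn leq_add2l.
rewrite rmorph_sum; apply: eq_bigr => j _.
have cB : (B j)^* = B j.
  rewrite rmorph_prod; apply: eq_bigr => i _.
  have := Re_f (p i * (1 - p i)); move: (f _) => v vR.
  by rewrite rmorphD rmorphM rmorphB rmorph1 /= vR (CrealP (Creal_Re _)).
have w0 : z ^+ j != 0 by rewrite expf_neq0.
have wn : (z ^+ j)^* = (z ^+ j)^-1 by rewrite [RHS]invC_norm norm_zX expr1n invr1 mul1r.
rewrite !mulrA rmorphM /= cB; congr (_ * _).
have -> : (z ^+ j) ^- (n + k) * (z ^+ j) ^+ n = (z ^+ j)^-1 ^+ k.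
  by rewrite -exprVn exprD mulrAC -exprMn mulVf // expr1n mul1r.
have -> : (z ^+ j) ^- (n - k) * (z ^+ j) ^+ n = (z ^+ j) ^+ k.
  by rewrite -{2}(subnK kn) exprD mulrA mulVf ?mul1r // expf_neq0.
by rewrite rmorphXn fmorphV /= wn invrK.
Qed.

(** The triangle inequality in the inversion formula bounds every atom by the average of the [B j],
    and this average is exactly the central atom of [T]. *)
Lemma coef_pgf_le_symmetrized k : (pgf p)`_k <= T`_n.
Proof.
have N0 : 0 < (N%:R : C) by rewrite ltr0n (prim_order_gt0 pz).
have T_n : N%:R * f T`_n = \sum_(j < N) B j.
  rewrite coef_symmetrized ?leq_double // -?addnn ?leq_addr //; apply: eq_bigr => j _.
  by rewrite mulKf // !expf_neq0.
have B_le j : `|(map_poly f (pgf p)).[z ^+ j]| <= B j.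
  rewrite /pgf !rmorph_prod horner_prod normr_prod ler_prod // => i _.
  rewrite normr_ge0 /=.
  have -> : (map_poly f (bern_poly (p i))).[z ^+ j] = 1 - f (p i) + f (p i) * z ^+ j.
    rewrite -[1 in RHS](rmorph1 f) -rmorphB.
    by rewrite [X in X.[_]]rmorphD [X in (_ + X).[_]]rmorphM /= !map_polyC map_polyX !hornerE.
  rewrite rmorphM rmorphB rmorph1; apply: norm_bern_le => //.
  by rewrite -(rmorph0 f) -(rmorph1 f) !f_le; apply: hp.
rewrite -f_le -(ler_pM2l N0) T_n.
case: (ltnP k N) => kN; last first.
  rewrite nth_default; last first.
    apply: leq_trans (size_pgf p) (leq_trans _ kN); apply: leq_ltn_trans nN.
    by rewrite -addnn leq_addr.
  by rewrite rmorph0 mulr0 sumr_ge0 // => j _; exact: le_trans (B_le j).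
apply: le_trans (real_ler_norm _) _; first by rewrite rpredM ?realn // CrealE Re_f.
rewrite -coef_map (fourier_coef pz) //; last first.
  apply: leq_trans (leq_trans (size_poly _ _) (size_pgf p)) _.
  by apply: leq_ltn_trans nN; rewrite -addnn leq_addr.
apply: le_trans (ler_norm_sum _ _ _) _; apply: ler_sum => j _.
by rewrite normrM normfV normrX norm_zX expr1n invr1 mul1r.
Qed.

End Fourier.

Lemma symmetrization (R : rcfType) (n : nat) (p : 'I_n -> R) : is_prob_vec p ->
  exists T : {poly R}, [/\ log_concave (fun k => T`_k), (size T <= n.*2.+1)%N,
   [/\ T.[1] = 1, T^`().[1] = n%:R &
       T^`()^`().[1] = n%:R ^+ 2 - n%:R + bern_sum_var p],
   forall k, (k <= n)%N -> T`_(n + k) = T`_(n - k) &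
   forall k, (pgf p)`_k <= T`_n].
Proof.
move=> hp.
have hv i : exists2 b, 0 <= b <= 1 & b * (1 - b) = p i * (1 - p i) / 2.
  apply: exists_half_variance; have /andP[p0 p1] := hp i; apply/andP; split.
    by rewrite mulr_ge0 ?subr_ge0.
  by have := sqr_ge0 (2 * p i - 1); lra.
have [b hb] : exists b : 'I_n -> R, forall i, 0 <= b i <= 1 /\ b i * (1 - b i) = p i * (1 - p i) / 2.
  (* The condition is put in boolean form so that [xchoose] can select all the [b i] at once. *)
  have c (i : 'I_n) : exists x, (0 <= x <= 1) && (x * (1 - x) == p i * (1 - p i) / 2).
    by have [x x01 /eqP xe] := hv i; exists x; rewrite x01.
  by exists (fun i => xchoose (c i)) => i; have /andP[? /eqP] := xchooseP (c i).
have hb1 : is_prob_vec b by move=> i; have [] := hb i.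
have hb2 : is_prob_vec (fun i => 1 - b i).
  by move=> i; have := hb1 i; rewrite subr_ge0 lerBlDr lerDl andbC.
have [z pz] := @prim_root_exists (R[i] : numClosedFieldType) n.*2.+1 isT.
have f_le : {mono (real_complex R : {rmorphism R -> (R[i] : numClosedFieldType)}) : x y / x <= y}.
  by move=> x y; rewrite lecR.
have hbv i : b i * (1 - b i) = p i * (1 - p i) / 2 by have [] := hb i.
exists (pgf b * pgf (fun i => 1 - b i)); split.
- exact/log_concave_pgfM/log_concave_pgf.
- apply: leq_trans (size_polyMleq _ _) _.
  have := size_pgf b; have := size_pgf (fun i => 1 - b i); rewrite -addnn; lia.
- have [D1 D2] := deriv_pgf b; have [D1' D2'] := deriv_pgf (fun i => 1 - b i).
  have S1 : \sum_(i < n) (1 - b i) = n%:R - \sum_(i < n) b i.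
    by rewrite sumrB sumr_const card_ord.
  have S2 : \sum_(i < n) (1 - b i) ^+ 2 = n%:R - \sum_(i < n) b i ^+ 2 - bern_sum_var p.
    rewrite /bern_sum_var -[n in n%:R]card_ord -sumr_const -!sumrB.
    by apply: eq_bigr => i _; have := hbv i; lra.
  rewrite derivM derivD !derivM !hornerD !hornerM !pgf1 D1 D1' D2 D2' S1 S2.
  by split; ring.
- by move=> k; apply: (coef_symmetrized_sym f_le hbv pz).
- by move=> k; apply: (coef_pgf_le_symmetrized f_le hp hbv pz).
Qed.

(** * Concentration of symmetric log-concave laws *)

Lemma moments_coef (R : comNzRingType) (N : nat) (T : {poly R}) : (size T <= N)%N ->
  [/\ T.[1] = \sum_(k < N) T`_k, T^`().[1] = \sum_(k < N) k%:R * T`_k &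
      T^`()^`().[1] = \sum_(k < N) (k%:R ^+ 2 - k%:R) * T`_k].
Proof.
move=> sT.
have {1 3 5}-> : T = \sum_(k < N) T`_k *: 'X^k.
  rewrite -poly_def; apply/polyP => i; rewrite coef_poly; case: ltnP => // Ni.
  by rewrite nth_default // (leq_trans sT).
split.
- by rewrite horner_sum; apply: eq_bigr => k _; rewrite hornerZ hornerXn expr1n mulr1.
- rewrite raddf_sum horner_sum; apply: eq_bigr => k _; rewrite /= derivZ derivXn hornerZ hornerMn hornerXn expr1n.
  exact: mulrC.
- rewrite !raddf_sum horner_sum; apply: eq_bigr => k _.
  rewrite /= derivZ derivXn derivZ derivMn derivXn hornerZ !hornerMn hornerXn expr1n mulrC.
  congr (_ * _); case: (k : nat) => [|j] /=; first by rewrite mulr0n; ring.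
  by rewrite -mulr_natr -[j.+1]addn1 natrD; ring.
Qed.

Lemma sum_ord_centered (V : nmodType) (n : nat) (g : nat -> V) :
  \sum_(k < n.*2.+1) g k = g n + \sum_(j < n) (g (n + j.+1)%N + g (n - j.+1)%N).
Proof.
rewrite -(big_mkord xpredT g) (@big_cat_nat _ _ _ n.+1) //=; last first.
  by rewrite ltnS -addnn leq_addr.
rewrite big_nat_recr //= big_nat_rev /= add0n addrAC addrC big_split /=; congr (_ + _).
rewrite addrC; congr (_ + _); last by rewrite big_mkord.
rewrite -{1}[n.+1]add0n big_addn subSS -addnn addnK big_mkord.
by apply: eq_bigr => j _; rewrite addnS addnC addnS.
Qed.

(* A tail of [t] is dominated by the geometric tail with ratio [t 1 / t 0]; the convolution below is the form of this that needs no division. *)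
Lemma convolution_ge (R : rcfType) (n : nat) (a b t : nat -> R) :
  (forall k, 0 <= t k) -> (forall k, 0 <= a k) -> (forall k, 0 <= b k) ->
  (forall i j, t 0%N * t (i + j)%N <= t i * t j) ->
  \sum_(k < n) (t 0%N * t k * \sum_(i < k.+1) a i * b (k - i)%N) <=
  (\sum_(i < n) a i * t i) * (\sum_(j < n) b j * t j).
Proof.
move=> t0 a0 b0 ht.
pose U := \poly_(i < n) (a i * t i); pose V := \poly_(i < n) (b i * t i).
have hU : \sum_(i < n) a i * t i = U.[1].
  rewrite horner_poly; apply: eq_bigr => i _; by rewrite expr1n mulr1.
have hV : \sum_(i < n) b i * t i = V.[1].
  rewrite horner_poly; apply: eq_bigr => i _; by rewrite expr1n mulr1.
have U0 k : 0 <= U`_k by rewrite coef_poly; case: ifP => // _; rewrite mulr_ge0.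
have V0 k : 0 <= V`_k by rewrite coef_poly; case: ifP => // _; rewrite mulr_ge0.
rewrite hU hV -hornerM (@horner_coef_wide _ (n + n)); last first.
  apply: leq_trans (size_polyMleq _ _) (leq_trans (leq_pred _) _).
  by apply: leq_add; apply: size_poly.
rewrite big_split_ord /= -[leLHS]addr0; apply: lerD; last first.
  by apply: sumr_ge0 => k _; rewrite expr1n mulr1 coefM sumr_ge0 // => i _; rewrite mulr_ge0.
apply: ler_sum => k _; rewrite expr1n mulr1 coefM mulr_sumr; apply: ler_sum => i _.
have ik : (i <= k)%N by rewrite -ltnS.
rewrite !coef_poly (leq_ltn_trans ik) // (leq_ltn_trans (leq_subr _ _)) //.
have := ht i (k - i)%N; rewrite subnKC // => h.
have : 0 <= (a i * b (k - i)%N) * (t i * t (k - i)%N - t 0%N * t k).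
  by rewrite !mulr_ge0 // subr_ge0.
by rewrite -subr_ge0; congr (0 <= _); ring.
Qed.

(** Here [t j] is the mass at distance [j] from the centre. With [D] the sum of [j * t j], one shows
    [t0 * B <= D] and [t0 * D <= A * (t0 + A)], where [A = (1 - t0) / 2]. Hence
    [t0^2 * B <= (1 - t0^2) / 4]. *)
Lemma log_concave_sym_concentration (R : rcfType) (n : nat) (t : nat -> R) :
  (forall k, 0 <= t k) -> (forall i j, t 0%N * t (i + j)%N <= t i * t j) ->
  t 0%N + 2 * \sum_(j < n) t j.+1 = 1 ->
  t 0%N ^+ 2 * (1 + 4 * \sum_(j < n) j.+1%:R ^+ 2 * t j.+1) <= 1.
Proof.
move=> t0 ht h1.
set A := \sum_(j < n) t j.+1 in h1; set B := \sum_(j < n) _ * _.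
pose D := \sum_(j < n) j.+1%:R * t j.+1.
(* Weights chosen for their convolutions: [pos] with the constant [1] gives [k], and [k] with [two]
   gives [k^2]. *)
pose pos (k : nat) : R := (0 < k)%N%:R.
pose two (k : nat) : R := if k == 0%N then 1 else 2.
have step1 : t 0%N * D <= A * (t 0%N + A).
  have pos0 k : 0 <= pos k by rewrite ler0n.
  have := @convolution_ge R n.+1 pos (fun=> 1) t t0 pos0 (fun=> ler01) ht.
  have cnt k : \sum_(i < k.+1) pos i * 1 = k%:R.
    rewrite big_ord_recl /pos mul0r add0r.
    by under eq_bigr do rewrite mulr1; rewrite sumr_const card_ord.
  under eq_bigr do rewrite cnt.
  rewrite !big_ord_recl mulr0 add0r /pos mul0r add0r mul1r.
  under eq_bigr do rewrite -mulrA [_ * _%:R]mulrC.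
  under [X in _ <= X * _]eq_bigr do rewrite mul1r.
  under [X in _ <= _ * (_ + X)]eq_bigr do rewrite mul1r.
  by rewrite -mulr_sumr.
have step2 : t 0%N * B <= D.
  have two0 k : 0 <= two k by rewrite /two; case: ifP.
  have := @convolution_ge R n.+1 (fun k => k%:R) two t t0 (fun k => ler0n R k) two0 ht.
  have cnt k : \sum_(i < k.+1) i%:R * two (k - i)%N = k%:R ^+ 2.
    rewrite big_ord_recr /= subnn /two eqxx mulr1.
    rewrite (eq_bigr (fun i : 'I_k => i%:R * 2)); last first.
      by move=> i _; rewrite subn_eq0 leqNgt ltn_ord.
    rewrite -mulr_suml; elim: k => [|k IH]; first by rewrite big_ord0; ring.
    by rewrite big_ord_recr /= mulrDl -[k.+1]addn1 natrD; lra.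
  under eq_bigr do rewrite cnt.
  rewrite !big_ord_recl expr0n mulr0 add0r mul0r add0r {2}/two mul1r.
  under eq_bigr do rewrite -mulrA [_ * _ ^+ 2]mulrC.
  under [X in _ <= _ * (_ + X)]eq_bigr do rewrite /two /=.
  by rewrite -!mulr_sumr -/A h1 mulr1.
have tt := t0 0%N.
have : t 0%N * (t 0%N * B) <= t 0%N * D by rewrite ler_wpM2l.
have A_eq : A = (1 - t 0%N) / 2 by lra.
rewrite A_eq in step1; lra.
Qed.

Lemma bern_sum_concentration (R : rcfType) (n : nat) (p : 'I_n -> R) (k : nat) :
  is_prob_vec p -> (pgf p)`_k ^+ 2 * (1 + 2 * bern_sum_var p) <= 1.
Proof.
move=> hp; have [T [[T0 TL] sT [h0 h1 h2] hs hk]] := symmetrization hp.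
have V0 : 0 <= bern_sum_var p.
  by apply: sumr_ge0 => i _; have /andP[p0 p1] := hp i; rewrite mulr_ge0 ?subr_ge0.
have P0 : 0 <= (pgf p)`_k by have [] := log_concave_pgf hp.
apply: (@le_trans _ _ (T`_n ^+ 2 * (1 + 2 * bern_sum_var p))).
  by rewrite ler_wpM2r ?addr_ge0 ?mulr_ge0 // ler_sqr ?nnegrE // hk.
pose t j := T`_(n + j).
have h i j : t 0%N * t (i + j)%N <= t i * t j by have := TL n i j; rewrite /t addn0 !addnA.
have [m0 m1 m2] := moments_coef sT.
have sum1 : t 0%N + 2 * \sum_(j < n) t j.+1 = 1.
  rewrite -[RHS]h0 m0 sum_ord_centered /t addn0 mulr_sumr; congr (_ + _).
  by apply: eq_bigr => j _; rewrite -hs ?ltn_ord // mulr_natl mulr2n.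
have sum2 : 2 * \sum_(j < n) j.+1%:R ^+ 2 * t j.+1 = bern_sum_var p.
  have -> : bern_sum_var p = \sum_(k < n.*2.+1) (k%:R - n%:R) ^+ 2 * T`_k.
    (* The second moment about the mean [n], through [(k-n)^2 = (k^2-k) + (1-2n)k + n^2]. *)
    have -> : \sum_(k < n.*2.+1) (k%:R - n%:R) ^+ 2 * T`_k =
       T^`()^`().[1] + (1 - 2 * n%:R) * T^`().[1] + n%:R ^+ 2 * T.[1].
      rewrite m0 m1 m2 !mulr_sumr -!big_split /=; apply: eq_bigr => j _; ring.
    by rewrite h0 h1 h2; ring.
  rewrite (sum_ord_centered n (fun k => (k%:R - n%:R) ^+ 2 * T`_k)) subrr expr0n mul0r add0r.
  rewrite mulr_sumr; apply: eq_bigr => j _; rewrite -hs ?ltn_ord // natrB ?ltn_ord //.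
  by rewrite natrD /t; ring.
have := @log_concave_sym_concentration R n t (fun j => T0 _) h sum1.
by rewrite -sum2 /t addn0 mulrA -natrM.
Qed.

(** * Total variation along a coordinate path *)

(** Unimodality: a descent at [j] followed by an ascent at [N] would contradict
    [f j * f (N+1) <= f (j+1) * f N]. *)
Lemma log_concave_nondecr (R : rcfType) (f : nat -> R) (N : nat) :
  log_concave f -> f N < f N.+1 -> forall j, (j <= N)%N -> f j <= f j.+1.
Proof.
move=> [f0 fL] lt j jN; rewrite leNgt; apply/negP => gt.
have := fL j 1%N (N - j)%N; rewrite !addn1 addSn subnKC // => h.
have h2 : f j.+1 * f N <= f j * f N by rewrite ler_wpM2r // ltW.
have fj : 0 < f j by exact: le_lt_trans (f0 _) gt.
by have := le_trans h h2; rewrite ler_pM2l // leNgt lt.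
Qed.

(** A unimodal sequence starting from [0] rises by at most [m] and then falls by at most [m - f N].
    Keeping the term [- f N] lets the induction absorb each descent. *)
Lemma log_concave_variation (R : rcfType) (f : nat -> R) (m : R) (N : nat) :
  log_concave f -> (forall k, f k <= m) ->
  \sum_(k < N.+1) `|f k - (if (k : nat) is j.+1 then f j else 0)| <= 2 * m - f N.
Proof.
move=> lf fm; have [f0 _] := lf.
elim: N => [|N IH].
  by rewrite big_ord_recl big_ord0 addr0 subr0 ger0_norm //; have := fm 0%N; lra.
rewrite big_ord_recr /=; case: (leP (f N.+1) (f N)) => [le|lt].
  by rewrite ler0_norm ?subr_le0 //; lra.
(* After an ascent at [N] the whole prefix is nondecreasing, so the sum telescopes. *)
suff e M : (M <= N)%N ->
  \sum_(k < M.+1) `|f k - (if (k : nat) is j.+1 then f j else 0)| = f M.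
  by rewrite e // ger0_norm ?subr_ge0 ?(ltW lt) //; have := fm N.+1; lra.
elim: M => [|M IHM] MN; first by rewrite big_ord_recl big_ord0 addr0 subr0 ger0_norm.
rewrite big_ord_recr /= IHM ?(ltnW MN) // ger0_norm; first by ring.
by rewrite subr_ge0 (log_concave_nondecr lf lt) // ltnW.
Qed.

Definition hybrid (R : rcfType) (n : nat) (p q : 'I_n -> R) (m : nat) (j : 'I_n) : R :=
  if (j < m)%N then q j else p j.

(* A coordinate set to [0] contributes nothing to the law nor to the variance. *)
Definition hybrid_rest (R : rcfType) (n : nat) (p q : 'I_n -> R) (i j : 'I_n) : R :=
  if j == i then 0 else hybrid p q i j.

Lemma pgf_hybrid_rest (R : rcfType) (n : nat) (p q g : 'I_n -> R) (i : 'I_n) :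
  (forall j, j != i -> g j = hybrid p q i j) ->
  pgf g = bern_poly (g i) * pgf (hybrid_rest p q i).
Proof.
move=> hg; rewrite /pgf (bigD1 i) //= [in RHS](bigD1 i) //=.
rewrite /hybrid_rest eqxx /bern_poly subr0 mul0r addr0 mul1r; congr (_ * _).
by apply: eq_bigr => j ji; rewrite (negbTE ji) hg.
Qed.

(** Telescoping along the hybrids: consecutive ones differ in the factor [i] only, and [bern_poly a
    - bern_poly a' = (a - a')(X - 1)]. *)
Lemma pgf_sub (R : rcfType) (n : nat) (p q : 'I_n -> R) :
  pgf p - pgf q = \sum_(i < n) (p i - q i)%:P * (('X - 1) * pgf (hybrid_rest p q i)).
Proof.
have -> : pgf p = pgf (hybrid p q 0) by apply: eq_bigr.
have -> : pgf q = pgf (hybrid p q n) by apply: eq_bigr => i _; rewrite /hybrid ltn_ord.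
rewrite -[LHS]opprB -(telescope_sumr (fun m => pgf (hybrid p q m)) (leq0n n)) big_mkord -sumrN.
apply: eq_bigr => i _.
rewrite (@pgf_hybrid_rest R n p q (hybrid p q i) i) // (@pgf_hybrid_rest R n p q (hybrid p q i.+1) i).
  by rewrite /hybrid ltnn ltnSn /bern_poly !polyCB; ring.
by move=> j ji; rewrite /hybrid ltnS leq_eqVlt; move: ji; rewrite -val_eqE => /negbTE ->.
Qed.

Lemma tv_bern_sumC (R : rcfType) (n : nat) (p q : 'I_n -> R) :
  tv_bern_sum p q = tv_bern_sum q p.
Proof. by congr (_ * _); apply: eq_bigr => k _; rewrite distrC. Qed.

Lemma tv_bern_sum_triangle (R : rcfType) (n : nat) (p r q : 'I_n -> R) :
  tv_bern_sum p q <= tv_bern_sum p r + tv_bern_sum r q.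
Proof.
rewrite /tv_bern_sum -mulrDr ler_wpM2l ?invr_ge0 // -big_split /=.
by apply: ler_sum => k _; exact: ler_distD.
Qed.

Lemma hybrid_rest_prob (R : rcfType) (n : nat) (p q : 'I_n -> R) (i : 'I_n) :
  is_prob_vec p -> is_prob_vec q -> is_prob_vec (hybrid_rest p q i).
Proof.
move=> hp hq j; rewrite /hybrid_rest /hybrid; case: eqP => _; first by rewrite lexx ler01.
by case: ifP.
Qed.

Lemma bern_sum_pmf_ge0 (R : rcfType) (n : nat) (p : 'I_n -> R) (k : nat) :
  is_prob_vec p -> 0 <= bern_sum_pmf p k.
Proof. by move=> hp; rewrite -coef_pgf; have [] := log_concave_pgf hp. Qed.

Lemma bern_sum_var_ge0 (R : rcfType) (n : nat) (p : 'I_n -> R) :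
  is_prob_vec p -> 0 <= bern_sum_var p.
Proof.
by move=> hp; apply: sumr_ge0 => i _; have /andP[p0 p1] := hp i; rewrite mulr_ge0 ?subr_ge0.
Qed.

Lemma tv_bern_sum_le1 (R : rcfType) (n : nat) (p q : 'I_n -> R) :
  is_prob_vec p -> is_prob_vec q -> tv_bern_sum p q <= 1.
Proof.
move=> hp hq; rewrite /tv_bern_sum.
have h (r : 'I_n -> R) : \sum_(k < n.+1) bern_sum_pmf r k = 1.
  rewrite -(pgf1 r) (horner_coef_wide _ (size_pgf r)).
  by apply: eq_bigr => k _; rewrite expr1n mulr1 coef_pgf.
have : \sum_(k < n.+1) `|bern_sum_pmf p k - bern_sum_pmf q k| <=
    \sum_(k < n.+1) (bern_sum_pmf p k + bern_sum_pmf q k).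
  apply: ler_sum => k _; apply: le_trans (ler_normB _ _) _.
  by rewrite !ger0_norm ?bern_sum_pmf_ge0.
rewrite big_split /= !h; lra.
Qed.

(** In [pgf_sub] the factor [X - 1] takes differences of consecutive atoms. These have total size at
    most [2 * m i] by unimodality, and the [2] cancels the half in the total variation distance. *)
Lemma tv_bern_sum_hybrid (R : rcfType) (n : nat) (p q m : 'I_n -> R) :
  is_prob_vec p -> is_prob_vec q ->
  (forall i k, bern_sum_pmf (hybrid_rest p q i) k <= m i) ->
  tv_bern_sum p q <= \sum_(i < n) `|p i - q i| * m i.
Proof.
move=> hp hq hm; rewrite /tv_bern_sum.
suff : \sum_(k < n.+1) `|bern_sum_pmf p k - bern_sum_pmf q k| <=
    \sum_(i < n) `|p i - q i| * (2 * m i).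
  under [X in _ <= X -> _]eq_bigr do rewrite mulrCA.
  by rewrite -mulr_sumr; lra.
pose g i k := (pgf (hybrid_rest p q i))`_k.
have e k : bern_sum_pmf p k - bern_sum_pmf q k =
    \sum_(i < n) (p i - q i) * ((if k is j.+1 then g i j else 0) - g i k).
  rewrite -!coef_pgf -coefB pgf_sub coef_sum; apply: eq_bigr => i _.
  by rewrite coefCM; congr (_ * _); rewrite mulrBl mul1r coefB coefXM; case: k.
apply: (@le_trans _ _ (\sum_(k < n.+1) \sum_(i < n) `|p i - q i| *
   `|g i k - (if (k : nat) is j.+1 then g i j else 0)|)).
  apply: ler_sum => k _; rewrite e; apply: le_trans (ler_norm_sum _ _ _) _.
  by apply: ler_sum => i _; rewrite normrM distrC [X in _ * X <= _]distrC.
rewrite exchange_big /=; apply: ler_sum => i _; rewrite -mulr_sumr ler_wpM2l //.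
have lg : log_concave (g i) by apply/log_concave_pgf/hybrid_rest_prob.
apply: le_trans (@log_concave_variation R (g i) (m i) n lg _) _.
  by move=> k; rewrite /g coef_pgf.
by rewrite gerBl; have [] := lg.
Qed.

(** At each [j] other than [i], one of the two opposite paths shows [p j] and the other [q j], so
    the sum does not depend on how far the paths have gone. *)
Lemma hybrid_rest_var (R : rcfType) (n : nat) (p q : 'I_n -> R) (i : 'I_n) :
  bern_sum_var (hybrid_rest p q i) + bern_sum_var (hybrid_rest q p i) =
  bern_sum_var p + bern_sum_var q - (p i * (1 - p i) + q i * (1 - q i)).
Proof.
rewrite /bern_sum_var -!big_split /= (bigD1 i) //= [in RHS](bigD1 i) //=.
rewrite /hybrid_rest eqxx !mul0r !add0r [RHS]addrAC subrr add0r.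
apply: eq_bigr => j /negbTE ji; rewrite ji /hybrid.
by case: ifP => // _; rewrite addrC.
Qed.

Lemma hybrid_rest_var_le (R : rcfType) (n : nat) (p q : 'I_n -> R) (w : 'I_n -> R) (i : 'I_n) :
  is_prob_vec w ->
  (forall j, p j * (1 - p j) <= w j * (1 - w j)) ->
  (forall j, q j * (1 - q j) <= w j * (1 - w j)) ->
  bern_sum_var (hybrid_rest p q i) <= bern_sum_var w.
Proof.
move=> hw hp hq; apply: ler_sum => j _; rewrite /hybrid_rest /hybrid.
case: eqP => _; last by case: ifP.
by have /andP[w0 w1] := hw j; rewrite mul0r mulr_ge0 ?subr_ge0.
Qed.

(** * The chord bound *)

(** The right-hand side is the chord of [1 / sqrt (1 + 2y)] between [y = 0] and [y = x], where the
    value is [1 / s]; its slope simplifies by [x = (s^2 - 1) / 2]. *)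
Lemma bern_sum_pmf_chord (R : rcfType) (n : nat) (p : 'I_n -> R) (x s : R) (k : nat) :
  is_prob_vec p -> 1 <= s -> s ^+ 2 = 1 + 2 * x -> bern_sum_var p <= x ->
  bern_sum_pmf p k <= 1 - 2 / (s * (s + 1)) * bern_sum_var p.
Proof.
move=> hp s1 sx; set y := bern_sum_var p => yx.
have y0 : 0 <= y by exact: bern_sum_var_ge0.
have P0 := bern_sum_pmf_ge0 k hp.
have := bern_sum_concentration k hp; rewrite coef_pgf -/y; set P := bern_sum_pmf _ _ in P0 *.
have h : 0 <= 1 + 2 * y by lra.
have := sqr_sqrtr h; have := sqrtr_ge0 (1 + 2 * y); set u := Num.sqrt _ => u0 uy.
have u1 : 1 <= u by nra.
have us : u <= s by nra.
rewrite -uy -exprMn => Pu.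
have {}Pu : P * u <= 1 by rewrite -(@ler_pXn2r _ 2) ?nnegrE ?mulr_ge0 ?expr1n.
have -> : y = (u ^+ 2 - 1) / 2 by rewrite uy; lra.
have ss : 0 < s * (s + 1) by nra.
have uu : 0 < u by lra.
rewrite -(ler_pM2r (mulr_gt0 ss uu)).
have -> : (1 - 2 / (s * (s + 1)) * ((u ^+ 2 - 1) / 2)) * (s * (s + 1) * u) =
  s * (s + 1) * u - (u ^+ 2 - 1) * u.
  by field; apply/andP; split; lra.
have h1 : P * (s * (s + 1) * u) <= s * (s + 1).
  by rewrite mulrCA ler_piMr // ltW.
(* With [u = sqrt (1 + 2y)], which lies between [1] and [s], this product is the gap between the
   chord and the curve after clearing denominators. *)
have h2 : 0 <= (u - 1) * (s * (s + 1) - u * (u + 1)) by rewrite mulr_ge0; nra.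
lra.
Qed.

Lemma tv_bern_sum_le_Delta (R : rcfType) (n : nat) (p q : 'I_n -> R) :
  is_prob_vec p -> is_prob_vec q -> tv_bern_sum p q <= Delta p q.
Proof.
move=> hp hq; have := @tv_bern_sum_hybrid R n p q (fun=> 1) hp hq.
under eq_bigr do rewrite mulr1; apply=> i k.
have hr := hybrid_rest_prob i hp hq; have y0 := bern_sum_var_ge0 hr.
have := @bern_sum_pmf_chord R n _ (bern_sum_var (hybrid_rest p q i))
  (Num.sqrt (1 + 2 * bern_sum_var (hybrid_rest p q i))) k hr.
set y := bern_sum_var _ in y0 *; set s := Num.sqrt _ => h.
have s0 : 0 <= s by exact: sqrtr_ge0.
have sy : s ^+ 2 = 1 + 2 * y by rewrite sqr_sqrtr //; lra.
have s1 : 1 <= s by nra.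
apply: le_trans (h s1 sy (lexx _)) _; rewrite gerBl mulr_ge0 // divr_ge0 //.
by rewrite mulr_ge0 // addr_ge0.
Qed.

(** * Scalar inequalities for the final estimate *)

(** [17/12] is a rational upper approximation of [sqrt 2], and [1 + 2x] is below [2 (x + 1)]. *)
Lemma chord_scale_le (R : rcfType) (x s tau : R) :
  0 <= tau -> tau ^+ 2 = x + 1 -> 1 <= s -> s ^+ 2 = 1 + 2 * x ->
  11 / 25 <= x -> s <= 17 / 12 * tau.
Proof.
move=> tau0 tau2 s1 s2 x1; have s0 : 0 <= s by lra.
have t0 : 0 <= 17 / 12 * tau by lra.
by rewrite -ler_sqr ?nnegrE // exprMn s2 tau2; lra.
Qed.

Lemma chord_large (R : rcfType) (x s tau : R) :
  0 <= tau -> tau ^+ 2 = x + 1 -> 1 <= s -> s ^+ 2 = 1 + 2 * x ->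
  1 <= x ->
  1 - 2 / (s * (s + 1)) * (x - 5 / 12 * tau) <= 6 / 5 / tau.
Proof.
move=> tau0 tau2 s1 s2 x1; have t1 : 7 / 5 <= tau.
  by rewrite -ler_sqr ?nnegrE ?divr_ge0 // tau2; lra.
have st : s <= 17 / 12 * tau by apply: (@chord_scale_le _ x) => //; lra.
have ss : 0 < s * (s + 1) by rewrite mulr_gt0; lra.
have tp : 0 < tau by lra.
rewrite -(ler_pM2r (mulr_gt0 ss tp)).
have -> : (1 - 2 / (s * (s + 1)) * (x - 5 / 12 * tau)) * (s * (s + 1) * tau) =
   (s * (s + 1)) * tau - 2 * (x - 5 / 12 * tau) * tau.
  by field; apply/andP; split; lra.
have -> : 6 / 5 / tau * (s * (s + 1) * tau) = 6 / 5 * (s * (s + 1)).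
  by field; lra.
have -> : s * (s + 1) = 2 * tau ^+ 2 - 1 + s by rewrite tau2; lra.
have -> : x = tau ^+ 2 - 1 by lra.
(* [s] enters linearly with coefficient [tau - 6/5 >= 0], so it may be replaced by [17/12 * tau]; a
   quadratic inequality in [tau] remains. *)
have : 0 <= (tau - 6 / 5) * (17 / 12 * tau - s) by rewrite mulr_ge0; lra.
have : 0 <= (tau - 7 / 5) * tau by rewrite mulr_ge0; lra.
have : 0 <= (tau - 7 / 5) * (tau - 7 / 5) by rewrite -expr2 sqr_ge0.
nra.
Qed.

Lemma chord_small (R : rcfType) (x s tau : R) :
  0 <= tau -> tau ^+ 2 = x + 1 -> 1 <= s -> s ^+ 2 = 1 + 2 * x ->
  11 / 25 <= x -> x <= 1 ->
  1 - 2 / (s * (s + 1)) * (x / 2 - 1 / 4 + 9 / 25 * (x / tau) ^+ 2) <= 6 / 5 / tau.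
Proof.
move=> tau0 tau2 s1 s2 x0 x1; have t1 : 6 / 5 <= tau.
  by rewrite -ler_sqr ?nnegrE ?divr_ge0 // tau2; lra.
have t2 : tau <= 17 / 12.
  by rewrite -ler_sqr ?nnegrE ?divr_ge0 // tau2; lra.
have st := chord_scale_le tau0 tau2 s1 s2 x0.
have ss : 0 < s * (s + 1) by rewrite mulr_gt0; lra.
have tp : 0 < tau by lra.
rewrite -(ler_pM2r (mulr_gt0 (mulr_gt0 ss tp) tp)).
have -> : (1 - 2 / (s * (s + 1)) * (x / 2 - 1 / 4 + 9 / 25 * (x / tau) ^+ 2)) * (s * (s + 1) * tau * tau) =
   (s * (s + 1)) * tau ^+ 2 - 2 * ((x / 2 - 1 / 4) * tau ^+ 2 + 9 / 25 * x ^+ 2).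
  by field; repeat (apply/andP; split); lra.
have -> : 6 / 5 / tau * (s * (s + 1) * tau * tau) = 6 / 5 * (s * (s + 1)) * tau.
  by field; lra.
have -> : s * (s + 1) = 2 * tau ^+ 2 - 1 + s by rewrite tau2; lra.
have -> : x = tau ^+ 2 - 1 by lra.
have h1 : 0 <= tau * (tau - 6 / 5) * (17 / 12 * tau - s) by rewrite !mulr_ge0; lra.
(* After [s] is replaced by its bound, a quartic in [tau] remains on [[6/5, 17/12]]; it is expanded
   at the left endpoint. *)
pose w := tau - 6 / 5.
have w0 : 0 <= w by rewrite /w; lra.
have w1 : w <= 13 / 60 by rewrite /w; lra.
suff : 0 <= - 7 / 25 * tau ^+ 4 + 59 / 60 * tau ^+ 3 - 6 / 25 * tau ^+ 2 - 6 / 5 * tau + 18 / 25.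
  lra.
have -> : tau = w + 6 / 5 by rewrite /w; lra.
nra.
Qed.


(** * The estimate for decreasing variances and the general case *)

(* [e] stands for [|1 - p_i - q_i|]: a coordinate moving from [p_i] to [q_i] changes the variance by [e |p_i - q_i|] and keeps a variance of at most [(1 - e ^ 2) / 4] on average, and [e ^ 2 >= 2 e0 e - e0 ^ 2] makes the bound linear in [e]. *)
Lemma rest_var_lower (R : rcfType) (n : nat) (p q : 'I_n -> R) (e0 : R) :
  (forall j, q j * (1 - q j) <= p j * (1 - p j)) ->
  let x := bern_sum_var p in let W := x - bern_sum_var q in
  Delta p q * (2 * x - W - 1 / 2 - e0 ^+ 2 / 2) + e0 * W <=
  \sum_(i < n) `|p i - q i| *
    (bern_sum_var p + bern_sum_var q - (p i * (1 - p i) + q i * (1 - q i))).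
Proof.
move=> hw /=; set x := bern_sum_var p; set x' := bern_sum_var q.
have W : x - x' = \sum_(i < n) `|p i - q i| * `|1 - p i - q i|.
  rewrite /x /x' /bern_sum_var -sumrB; apply: eq_bigr => i _.
  by rewrite -normrM -[LHS]ger0_norm ?subr_ge0 //; congr `|_|; ring.
move: x x' W => x x' W; rewrite {2}W /Delta mulr_suml mulr_sumr -big_split /=; apply: ler_sum => i _.
rewrite mulrCA -mulrDr ler_wpM2l //.
have := sqr_ge0 (`|1 - p i - q i| - e0).
have : `|1 - p i - q i| ^+ 2 = (1 - p i - q i) ^+ 2 by rewrite real_normK ?num_real.
have := sqr_ge0 (p i - q i).
nra.
Qed.

Lemma tv_bern_sum_var_decr (R : rcfType) (n : nat) (p q : 'I_n -> R) :
  is_prob_vec p -> is_prob_vec q ->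
  (forall j, q j * (1 - q j) <= p j * (1 - p j)) ->
  tv_bern_sum p q <= 6 / 5 * (Delta p q / Num.sqrt (bern_sum_var p + 1)).
Proof.
move=> hp hq hw.
have low e0 := rest_var_lower e0 hw; rewrite /= in low.
have x0 := bern_sum_var_ge0 hp; have x'0 := bern_sum_var_ge0 hq.
have TV1 := tv_bern_sum_le1 hp hq; have TVD := tv_bern_sum_le_Delta hp hq.
have D0 : 0 <= Delta p q by exact: sumr_ge0.
have WD : bern_sum_var p - bern_sum_var q <= Delta p q.
  rewrite /bern_sum_var -sumrB; apply: ler_sum => i _.
  have -> : p i * (1 - p i) - q i * (1 - q i) = (p i - q i) * (1 - p i - q i) by ring.
  apply: le_trans (ler_norm _) _; rewrite normrM ler_piMr // ler_norml.
  by have := hp i; have := hq i; lra.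
have W0 : bern_sum_var q <= bern_sum_var p by exact: ler_sum.
(* The chord bounds for the paths from [p] to [q] and from [q] to [p] are added; by
   [hybrid_rest_var] only the sum of the two rest variances enters. *)
have hyb (s : R) : 1 <= s -> s ^+ 2 = 1 + 2 * bern_sum_var p ->
    2 * tv_bern_sum p q <= 2 * Delta p q - 2 / (s * (s + 1)) *
    \sum_(i < n) `|p i - q i| *
    (bern_sum_var p + bern_sum_var q - (p i * (1 - p i) + q i * (1 - q i))).
  move=> s1 s2; set b := 2 / _.
  have h1 := @tv_bern_sum_hybrid R n p q
    (fun i => 1 - b * bern_sum_var (hybrid_rest p q i)) hp hq.
  have h2 := @tv_bern_sum_hybrid R n q p
    (fun i => 1 - b * bern_sum_var (hybrid_rest q p i)) hq hp.
  have {}h1 := h1 (fun i k => bern_sum_pmf_chord k (hybrid_rest_prob i hp hq) s1 s2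
    (hybrid_rest_var_le i hp (fun j => lexx _) hw)).
  have {}h2 := h2 (fun i k => bern_sum_pmf_chord k (hybrid_rest_prob i hq hp) s1 s2
    (hybrid_rest_var_le i hp hw (fun j => lexx _))).
  rewrite mulr2n mulrDl mul1r {2}tv_bern_sumC; apply: le_trans (lerD h1 h2) _.
  rewrite /Delta -big_split /= !mulr_sumr -sumrB; apply: ler_sum => i _.
  rewrite -hybrid_rest_var [`|q i - p i|]distrC; lra.
have x10 : 0 <= bern_sum_var p + 1 by lra.
have x20 : 0 <= 1 + 2 * bern_sum_var p by lra.
have := sqr_sqrtr x10; have := sqrtr_ge0 (bern_sum_var p + 1).
have := sqr_sqrtr x20; have := sqrtr_ge0 (1 + 2 * bern_sum_var p).
set s := Num.sqrt (1 + _); set tau := Num.sqrt _ => s0 s2 tau0 tau2.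
have {}hyb := hyb s _ s2.
move: low hyb; set S := \sum_(i < n) _ => low hyb.
move: (bern_sum_var p) (bern_sum_var q) (Delta p q) (tv_bern_sum p q) S
  low hyb x0 x'0 TV1 TVD D0 WD W0 x10 x20 s2 tau2.
move=> x x' D TV S low hyb x0 x'0 TV1 TVD D0 WD W0 _ _ s2 tau2.
have tp : 0 < tau by rewrite lt_def tau0 andbT -sqrf_eq0 tau2; apply/eqP; lra.
rewrite mulrA ler_pdivlMr //.
have s1 : 1 <= s by rewrite -ler_sqr ?nnegrE // expr1n s2; lra.
have {}hyb := hyb s1.
(* [11/25 = (6/5)^2 - 1]: below it [tau <= 6/5], and [TV <= D] suffices. *)
case: (ltP x (11 / 25)) => [xs|xs].
  have ts : tau <= 6 / 5 by rewrite -ler_sqr ?nnegrE ?divr_ge0 // tau2; lra.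
  by apply: le_trans (ler_wpM2r tau0 TVD) _; rewrite mulrC ler_wpM2r.
(* For such large [D] the trivial bound [TV <= 1] suffices; afterwards [D < 5/6 * tau]. *)
case: (leP tau (6 / 5 * D)) => [Dl|Ds].
  by apply: le_trans Dl; rewrite ler_piMl.
set b := 2 / _ in hyb.
have b0 : 0 <= b by rewrite divr_ge0 // mulr_ge0 //; lra.
suff [K hK SK] : exists2 K, 1 - b * K <= 6 / 5 / tau & 2 * D * K <= S.
  have : 2 * TV <= 2 * D * (1 - b * K).
    by apply: le_trans hyb _; have := ler_wpM2l b0 SK; lra.
  have : D * (1 - b * K) <= D * (6 / 5 / tau) by rewrite ler_wpM2l.
  move=> h1 h2; have {}h1 : TV <= D * (6 / 5 / tau) by lra.
  apply: le_trans (ler_wpM2r tau0 h1) _.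
  by rewrite mulrA divfK ?gt_eqF // mulrC.
case: (leP 1 x) => [x1|x1].
  (* The value of the lower bound [low 1], divided by [2 * D], at the extreme point
     [W = D = 5/6 * tau]. *)
  exists (x - 5 / 12 * tau); first exact: chord_large.
  apply: le_trans (low 1).
  have t1 : 6 / 5 <= tau by rewrite -ler_sqr ?nnegrE ?divr_ge0 // tau2; lra.
  rewrite -subr_ge0; set W := x - x' in WD *.
  have -> : D * (2 * x - W - 1 / 2 - 1 ^+ 2 / 2) + 1 * W - 2 * D * (x - 5 / 12 * tau) =
    D * (5 / 6 * tau - 1) - W * (D - 1) by field.
  case: (leP D 1) => D1.
    have : 0 <= D * (5 / 6 * tau - 1) by rewrite mulr_ge0; lra.
    have : 0 <= W * (1 - D) by rewrite mulr_ge0 /W; lra.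
    lra.
  have : 0 <= D * (5 / 6 * tau - D) by rewrite mulr_ge0; lra.
  have : 0 <= (D - W) * (D - 1) by rewrite mulr_ge0; lra.
  lra.
(* The same quotient at the extreme point [W = x], [D = 5/6 * tau]. The best [e0] is [W / D], which
   here is [6/5 * (x / tau)]. *)
exists (x / 2 - 1 / 4 + 9 / 25 * (x / tau) ^+ 2); first by apply: chord_small => //; lra.
pose e0 := 6 / 5 * (x / tau).
have e00 : 0 <= e0 by rewrite mulr_ge0 ?divr_ge0.
have e0D : e0 * D <= x.
  rewrite /e0 mulrAC mulrA ler_pdivrMr //.
  by rewrite mulrC ler_wpM2l // ltW.
have e0x : e0 ^+ 2 <= x.
  have -> : e0 ^+ 2 = 36 / 25 * x ^+ 2 / (x + 1) by rewrite -tau2 /e0; field; lra.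
  rewrite ler_pdivrMr; last by lra.
  nra.
apply: le_trans (low e0); rewrite -subr_ge0; set W := x - x'.
have -> : D * (2 * x - W - 1 / 2 - e0 ^+ 2 / 2) + e0 * W -
    2 * D * (x / 2 - 1 / 4 + 9 / 25 * (x / tau) ^+ 2) =
    D * (x - e0 ^+ 2) - W * (D - e0).
  by rewrite /e0; field; lra.
case: (leP D e0) => De.
  have : 0 <= D * (x - e0 ^+ 2) by rewrite mulr_ge0; lra.
  have : 0 <= W * (e0 - D) by rewrite mulr_ge0 /W; lra.
  lra.
have : 0 <= e0 * (x - e0 * D) by rewrite mulr_ge0; lra.
have : 0 <= (x - W) * (D - e0) by rewrite mulr_ge0 /W; lra.
lra.
Qed.

(** The detour through [r] costs nothing: [r] equals [p] or [q] in each coordinate, so the two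
    [Delta] add up to [Delta p q], and the variance of [r] is at least that of [p]. *)
Lemma tv_bern_sum_le (R : rcfType) (n : nat) (p q : 'I_n -> R) :
  is_prob_vec p -> is_prob_vec q ->
  tv_bern_sum p q <= 6 / 5 * (Delta p q / Num.sqrt (bern_sum_var p + 1)).
Proof.
move=> hp hq.
pose r i := if q i * (1 - q i) <= p i * (1 - p i) then p i else q i.
have hr : is_prob_vec r by move=> i; rewrite /r; case: ifP.
have rp i : p i * (1 - p i) <= r i * (1 - r i) 
  by rewrite /r; case: ifP => // /negbT; rewrite -ltNge => /ltW.
have rq i : q i * (1 - q i) <= r i * (1 - r i) by rewrite /r; case: ifP.
have D0 (a b : 'I_n -> R) : 0 <= Delta a b by exact: sumr_ge0.
have h1 := tv_bern_sum_var_decr hr hp rp; have h2 := tv_bern_sum_var_decr hr hq rq.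
apply: le_trans (tv_bern_sum_triangle p r q) _; rewrite tv_bern_sumC.
apply: le_trans (lerD h1 h2) _; rewrite -mulrDr -mulrDl ler_wpM2l ?divr_ge0 //.
have -> : Delta r p + Delta r q = Delta p q.
  rewrite /Delta -big_split; apply: eq_bigr => i _ /=; rewrite /r.
  by case: ifP => _; rewrite subrr normr0 ?add0r ?addr0 // distrC.
have x0 := bern_sum_var_ge0 hp.
have xr : bern_sum_var p <= bern_sum_var r by exact: ler_sum.
rewrite ler_wpM2l // lef_pV2 ?posrE ?sqrtr_gt0; [|lra|lra].
by rewrite ler_wsqrtr // lerD2r.
Qed.

(** * The lower bound on the constant, and the conclusion *)

(* Four parameters [1/10] and four parameters [9/10], at the centre [k = 4]. *)
Lemma bcv_valid_sqr_ge (R : rcfType) (c : R) : bcv_valid c -> 19 / 100 <= c ^+ 2.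
Proof.
move=> hc; pose p (i : 'I_8) : R := if (i < 4)%N then 1 / 10 else 9 / 10.
have hp : is_prob_vec p by move=> i; rewrite /p; case: ifP => _; lra.
have vp : bern_sum_var p = 18 / 25.
  rewrite /bern_sum_var !big_ord_recl big_ord0 /p /=; lra.
(* Pairing [1/10] with [9/10] gives the symmetric law [9/100, 41/50, 9/100]; the atom sought is the
   central coefficient of [Q^4]. *)
pose Q : {poly R} := bern_poly (1 / 10) * bern_poly (9 / 10).
have bern_coef (a : R) k : (bern_poly a)`_k = if k is 0 then 1 - a else if k is 1 then a else 0.
  by rewrite -[bern_poly a]mulr1 coef_bern_polyM !coef1; case: k => [|[|k]] /=; rewrite ?coef1 /=; lra.
have eQ k : Q`_k = if k is 0 then 9 / 100 else if k is 1 then 41 / 50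
    else if k is 2 then 9 / 100 else 0.
  by rewrite coef_bern_polyM !bern_coef; case: k => [|[|[|k]]] /=; rewrite ?bern_coef /=; lra.
have Ep : pgf p = (Q * Q) * (Q * Q).
  rewrite /pgf !big_ord_recl big_ord0 /p /= /Q; ring.
have Pk : bern_sum_pmf p 4 = 
    (41 / 50) ^+ 4 + 12 * (9 / 100) ^+ 2 * (41 / 50) ^+ 2 + 6 * (9 / 100) ^+ 4.
  rewrite -coef_pgf Ep coefM !big_ord_recl big_ord0 !coefM !big_ord_recl !big_ord0 /= !eQ /=.
  lra.
have := hc 8%N p hp; rewrite vp => /(_ _ 4%N); rewrite Pk.
have v0 : 0 < (18 / 25 : R) by lra.
move=> /(_ v0); rewrite ler_pdivlMr ?sqrtr_gt0 //.
have := sqr_sqrtr (ltW v0); have := sqrtr_ge0 (18 / 25 : R).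
set s := Num.sqrt _ => s0 s2; set P := (P in P * s) => hs.
(* A rounding of the atom that is still sharp enough: [(129/250)^2 * 18/25 > 19/100]. *)
have P_ge : 129 / 250 <= P by rewrite /P; lra.
have cs : 129 / 250 * s <= c by apply: le_trans hs; rewrite ler_wpM2r.
have cs0 : 0 <= 129 / 250 * s by rewrite mulr_ge0 // divr_ge0.
have : (129 / 250 * s) ^+ 2 <= c ^+ 2.
  by rewrite ler_sqr ?nnegrE // (le_trans cs0 cs).
by rewrite exprMn s2; lra.
Qed.

(** [19/100] is what is missing: [5/4 + 19/100 = (6/5)^2]. *)
Lemma C_BCV_ge (R : rcfType) (eta : R) : bcv_valid eta -> 6 / 5 <= C_BCV eta.
Proof.
move=> /bcv_valid_sqr_ge h; rewrite /C_BCV.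
have h0 : 0 <= 5 / 4 + eta ^+ 2 by lra.
by rewrite -ler_sqr ?nnegrE ?sqrtr_ge0 ?divr_ge0 // sqr_sqrtr //; lra.
Qed.

Theorem theorem1 (R : rcfType) (eta : R) (heta : is_eta_BCV eta)
  (n : nat) (hn : (1 <= n)%N) (p q : 'I_n -> R)
  (hp : is_prob_vec p) (hq : is_prob_vec q) :
  tv_bern_sum p q <= C_BCV eta * Num.min (Phi p q) (Phi q p).
Proof.
have [/C_BCV_ge C65 _] := heta.
(* The total variation distance is symmetric, so a bound by one [Phi], for all pairs of vectors,
   covers both terms of the minimum. *)
suff PhiP (a b : 'I_n -> R) : is_prob_vec a -> is_prob_vec b ->
    tv_bern_sum a b <= C_BCV eta * Phi a b.
  by rewrite minEle; case: ifP => _; [|rewrite tv_bern_sumC]; exact: PhiP.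
move=> ha hb; rewrite /Phi minEle; case: ifP => _.
  by have := tv_bern_sum_le1 ha hb; lra.
apply: le_trans (tv_bern_sum_le ha hb) _; rewrite ler_wpM2r //.
by rewrite divr_ge0 ?sqrtr_ge0 // sumr_ge0.
Qed.
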